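(* Let $R$ be a commutative ring with $1$, let $a,b\in R$, and let $m,n\ge 1$ be integers. Let $M$ be a left $H_m$-module and $N$ a left $H_n$-module. Then there are the following isomorphisms of $H_{m+n}$-modules: (1) $\phi[M \boxtimes N] \cong \phi[N] \boxtimes \phi[M]$; (2) $\theta[M \boxtimes N] \cong \theta[M] \boxtimes \theta[N]$; (3) $\omega[M \boxtimes N] \cong \omega[N] \boxtimes \omega[M]$. For every left $H_{m+n}$-module $L$ there are the following isomorphisms of $H_m \otimes H_n$-modules: (4) $\phi\big[L \downarrow^{H_{m+n}}_{H_n \otimes H_m}\big] \cong \phi[L] \downarrow^{H_{m+n}}_{H_m \otimes H_n}$; (5) $\theta\big[L \downarrow^{H_{m+n}}_{H_m \otimes H_n}\big] \cong \theta[L] \downarrow^{H_{m+n}}_{H_m \otimes H_n}$; (6) if $L$ is a free $R$-module of finite rank, then $\chi\big[L \downarrow^{H_{m+n}}_{H_m \otimes H_n}\big] \cong \chi[L] \downarrow^{H_{m+n}}_{H_m \otimes H_n}$.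
   Context: All unadorned tensor products are over $R$. $H_n:=H_{\mathfrak{S}_n}(a,b)$ is the unital $R$-algebra generated by $\pi_1,\dots,\pi_{n-1}$ with relations $\pi_i^2=a\pi_i+b$, $\pi_i\pi_{i+1}\pi_i=\pi_{i+1}\pi_i\pi_{i+1}$, and $\pi_i\pi_j=\pi_j\pi_i$ for $|i-j|\ge 2$. $H_m\otimes H_n$ is identified with the subalgebra of $H_{m+n}$ generated by $\pi_i$, $i\neq m$, via $\pi_i\otimes 1\mapsto\pi_i$, $1\otimes\pi_j\mapsto\pi_{m+j}$. For a subalgebra $B\subseteq A$: $N\uparrow^A_B:=A\otimes_B N$ for a left $B$-module $N$, and $L\downarrow^A_B$ is the left $A$-module $L$ regarded as a $B$-module. The induction product is $M\boxtimes N:=(M\otimes N)\uparrow^{H_{m+n}}_{H_m\otimes H_n}$. For each $n$, $\phi$ and $\theta$ are the algebra automorphisms of $H_n$ given by $\phi(\pi_i)=\pi_{n-i}$ (that is, $\pi_s\mapsto\pi_{w_0sw_0}$ with $w_0$ the longest element of $\mathfrak{S}_n$) and $\theta(\pi_i)=a-\pi_i$; $\chi$ is the algebra anti-automorphism of $H_n$ with $\chi(\pi_i)=\pi_i$; and $\omega:=\phi\circ\theta$. The same letters are used for every $n$. Twists: for an algebra homomorphism $\mu:B\to A$ and a left $A$-module $V$, $\mu[V]$ is the left $B$-module with the same underlying module and action $b\cdot^\mu v:=\mu(b)\cdot v$. For an anti-homomorphism $\nu:B\to A$, $\nu[V]$ is the left $B$-module with underlying module $V^*=\mathrm{Hom}_R(V,R)$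 and action $(b\cdot^\nu\delta)(v):=\delta(\nu(b)\cdot v)$. On the left-hand sides of (4), (5), (6) the twists are along the restrictions of the maps $\phi,\theta,\chi$ of $H_{m+n}$, namely $\phi:H_m\otimes H_n\to H_n\otimes H_m$, $\theta:H_m\otimes H_n\to H_m\otimes H_n$, $\chi:H_m\otimes H_n\to H_m\otimes H_n$. *)

(* Defs.v *)
From HB Require Import structures.
From mathcomp Require Import all_boot all_algebra.
From mathcomp Require Import mathcomp_extra boolp functions.
From mathcomp Require Import zify.

Set Implicit Arguments.
Unset Strict Implicit.
Unset Printing Implicit Defensive.

Import GRing.Theory.
Local Open Scope ring_scope.
Local Open Scope quotient_scope.

(* Associative unital R-algebras, given by a central ring morphism R -> A. The
   library's algType is not used because it requires 1 != 0, which fails for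
   the algebras below when R is the zero ring. *)
HB.mixin Record PzRing_isAlg (R : comPzRingType) A of GRing.PzRing A := {
  in_pzalg : {rmorphism R -> A};
  in_pzalgC : forall (r : R) (x : A), in_pzalg r * x = x * in_pzalg r
}.

#[short(type="pzAlgType")]
HB.structure Definition PzAlg (R : comPzRingType) :=
  {A of GRing.PzRing A & PzRing_isAlg R A}.

HB.mixin Record isAlgHom (R : comPzRingType) (A B : pzAlgType R) (f : A -> B) :=
  { alghom_in_pzalg : forall r : R, f (in_pzalg r) = in_pzalg r }.

HB.structure Definition AlgHom (R : comPzRingType) (A B : pzAlgType R) :=
  {f of @GRing.RMorphism A B f & isAlgHom R A B f}.

Notation "{ 'alghom' A -> B }" := (AlgHom.type A%type B%type)
  (at level 0, A at level 98, B at level 99, format "{ 'alghom'  A  ->  B }")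
  : type_scope.

Section AlgTheory.
Variable R : comPzRingType.
Implicit Types A B C : pzAlgType R.

Section Converse.
Variable A : pzAlgType R.

Definition in_conv (r : R) : A^c := in_pzalg r.

Fact in_conv_is_zmod_morphism : zmod_morphism in_conv.
Proof. exact: (rmorphB (@in_pzalg R A)). Qed.

Fact in_conv_is_monoid_morphism : monoid_morphism in_conv.
Proof.
split=> [|r s]; first exact: (rmorph1 (@in_pzalg R A)).
by rewrite /in_conv rmorphM; exact: in_pzalgC.
Qed.

HB.instance Definition _ :=
  GRing.isZmodMorphism.Build R A^c in_conv in_conv_is_zmod_morphism.
HB.instance Definition _ :=
  GRing.isMonoidMorphism.Build R A^c in_conv in_conv_is_monoid_morphism.

Fact in_convC (r : R) (x : A^c) : in_conv r * x = x * in_conv r.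
Proof. by symmetry; exact: (@in_pzalgC R A). Qed.

HB.instance Definition _ := PzRing_isAlg.Build R A^c in_convC.

End Converse.

Section Comp.
Variables (A B C : pzAlgType R) (g : {alghom B -> C}) (f : {alghom A -> B}).

Fact comp_in_pzalg (r : R) : (g \o f) (in_pzalg r) = in_pzalg r.
Proof. by rewrite /= !alghom_in_pzalg. Qed.

HB.instance Definition _ := isAlgHom.Build R A C (g \o f) comp_in_pzalg.
End Comp.

End AlgTheory.

(* The R-algebra with generators X and defining relations rel, as the quotient
   of the algebra terms over X by the congruence generated by the axioms of
   unital associative R-algebras and by rel. *)
Section Presentation.
Variables (R : comPzRingType) (X : Type).

Inductive aterm : Type :=
  | ACst of R
  | AGen of X
  | AAdd of aterm & aterm
  | AMul of aterm & aterm.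

HB.instance Definition _ := gen_eqMixin aterm.
HB.instance Definition _ := gen_choiceMixin aterm.

Fixpoint aeval (A : pzAlgType R) (g : X -> A) (t : aterm) : A :=
  match t with
  | ACst r => in_pzalg r
  | AGen i => g i
  | AAdd s t => aeval g s + aeval g t
  | AMul s t => aeval g s * aeval g t
  end.

Variable rel : aterm -> aterm -> Prop.

Inductive acong : aterm -> aterm -> Prop :=
  | acong_refl s : acong s s
  | acong_sym s t : acong s t -> acong t s
  | acong_trans s t u : acong s t -> acong t u -> acong s u
  | acong_add s s' t t' : acong s s' -> acong t t' ->
      acong (AAdd s t) (AAdd s' t')
  | acong_mul s s' t t' : acong s s' -> acong t t' ->
      acong (AMul s t) (AMul s' t')
  | acong_addA s t u : acong (AAdd s (AAdd t u)) (AAdd (AAdd s t) u)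
  | acong_addC s t : acong (AAdd s t) (AAdd t s)
  | acong_add0 s : acong (AAdd (ACst 0) s) s
  | acong_addN s : acong (AAdd (AMul (ACst (- 1)) s) s) (ACst 0)
  | acong_mulA s t u : acong (AMul s (AMul t u)) (AMul (AMul s t) u)
  | acong_mul1l s : acong (AMul (ACst 1) s) s
  | acong_mul1r s : acong (AMul s (ACst 1)) s
  | acong_mulDl s t u : acong (AMul (AAdd s t) u) (AAdd (AMul s u) (AMul t u))
  | acong_mulDr s t u : acong (AMul s (AAdd t u)) (AAdd (AMul s t) (AMul s u))
  | acong_cstD r r' : acong (ACst (r + r')) (AAdd (ACst r) (ACst r'))
  | acong_cstM r r' : acong (ACst (r * r')) (AMul (ACst r) (ACst r'))
  | acong_cstC r s : acong (AMul (ACst r) s) (AMul s (ACst r))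
  | acong_rel s t : rel s t -> acong s t.

Definition acongb (s t : aterm) : bool := `[< acong s t >].

Fact acongb_equiv : equiv_class_of acongb.
Proof.
split=> [s|s t|t s u].
- by apply/asboolP; exact: acong_refl.
- by apply/asboolP/asboolP; exact: acong_sym.
- by move=> /asboolP st /asboolP tu; apply/asboolP; exact: acong_trans tu.
Qed.

Canonical acongb_equiv_rel := EquivRelPack acongb_equiv.

Definition presalg : Type := {eq_quot acongb}.
HB.instance Definition _ := Choice.on presalg.
HB.instance Definition _ := EqQuotient.on presalg.

Lemma presalg_eqP (s t : aterm) :
  reflect (\pi_presalg s = \pi_presalg t) (acongb s t).
Proof. exact: eqmodP. Qed.

Lemma presalg_pi_eq (s t : aterm) :
  acong s t -> \pi_presalg s = \pi_presalg t.
Proof. by move=> st; apply/presalg_eqP/asboolP. Qed.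

Lemma presalg_reprP (s : aterm) : acong (repr (\pi_presalg s)) s.
Proof. by apply/asboolP/presalg_eqP; rewrite reprK. Qed.

Definition pres_cst (r : R) : presalg := \pi_presalg (ACst r).
Definition pres_gen (i : X) : presalg := \pi_presalg (AGen i).
Definition pres_add (x y : presalg) : presalg :=
  \pi_presalg (AAdd (repr x) (repr y)).
Definition pres_opp (x : presalg) : presalg :=
  \pi_presalg (AMul (ACst (- 1)) (repr x)).
Definition pres_mul (x y : presalg) : presalg :=
  \pi_presalg (AMul (repr x) (repr y)).

Lemma pres_addE s t :
  pres_add (\pi s) (\pi t) = \pi_presalg (AAdd s t).
Proof. by apply/presalg_pi_eq/acong_add; exact: presalg_reprP. Qed.

Lemma pres_mulE s t :
  pres_mul (\pi s) (\pi t) = \pi_presalg (AMul s t).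
Proof. by apply/presalg_pi_eq/acong_mul; exact: presalg_reprP. Qed.

Lemma pres_oppE s :
  pres_opp (\pi s) = \pi_presalg (AMul (ACst (- 1)) s).
Proof.
apply/presalg_pi_eq/acong_mul; first exact: acong_refl.
exact: presalg_reprP.
Qed.

Let presE := (pres_addE, pres_mulE, pres_oppE).

Fact pres_addA : associative pres_add.
Proof.
elim/quotW=> s; elim/quotW=> t; elim/quotW=> u.
by rewrite !presE; exact/presalg_pi_eq/acong_addA.
Qed.

Fact pres_addC : commutative pres_add.
Proof.
elim/quotW=> s; elim/quotW=> t.
by rewrite !presE; exact/presalg_pi_eq/acong_addC.
Qed.

Fact pres_add0 : left_id (pres_cst 0) pres_add.
Proof. by elim/quotW=> s; rewrite presE; exact/presalg_pi_eq/acong_add0. Qed.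

Fact pres_addN : left_inverse (pres_cst 0) pres_opp pres_add.
Proof. by elim/quotW=> s; rewrite !presE; exact/presalg_pi_eq/acong_addN. Qed.

Fact pres_mulA : associative pres_mul.
Proof.
elim/quotW=> s; elim/quotW=> t; elim/quotW=> u.
by rewrite !presE; exact/presalg_pi_eq/acong_mulA.
Qed.

Fact pres_mul1l : left_id (pres_cst 1) pres_mul.
Proof. by elim/quotW=> s; rewrite presE; exact/presalg_pi_eq/acong_mul1l. Qed.

Fact pres_mul1r : right_id (pres_cst 1) pres_mul.
Proof. by elim/quotW=> s; rewrite presE; exact/presalg_pi_eq/acong_mul1r. Qed.

Fact pres_mulDl : left_distributive pres_mul pres_add.
Proof.
elim/quotW=> s; elim/quotW=> t; elim/quotW=> u.
by rewrite !presE; exact/presalg_pi_eq/acong_mulDl.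
Qed.

Fact pres_mulDr : right_distributive pres_mul pres_add.
Proof.
elim/quotW=> s; elim/quotW=> t; elim/quotW=> u.
by rewrite !presE; exact/presalg_pi_eq/acong_mulDr.
Qed.

HB.instance Definition _ :=
  GRing.isZmodule.Build presalg pres_addA pres_addC pres_add0 pres_addN.
HB.instance Definition _ := GRing.Zmodule_isPzRing.Build presalg
  pres_mulA pres_mul1l pres_mul1r pres_mulDl pres_mulDr.

Fact pres_cst_is_nmod_morphism : nmod_morphism pres_cst.
Proof.
split=> // r s; rewrite [RHS]pres_addE.
exact/presalg_pi_eq/acong_cstD.
Qed.

Fact pres_cst_is_monoid_morphism : monoid_morphism pres_cst.
Proof.
split=> // r s; rewrite [RHS]pres_mulE.
exact/presalg_pi_eq/acong_cstM.
Qed.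

HB.instance Definition _ :=
  GRing.isNmodMorphism.Build R presalg pres_cst pres_cst_is_nmod_morphism.
HB.instance Definition _ :=
  GRing.isMonoidMorphism.Build R presalg pres_cst pres_cst_is_monoid_morphism.

Fact pres_cstC (r : R) (x : presalg) : pres_cst r * x = x * pres_cst r.
Proof.
elim/quotW: x => s.
by rewrite [LHS]pres_mulE [RHS]pres_mulE; exact/presalg_pi_eq/acong_cstC.
Qed.

HB.instance Definition _ := PzRing_isAlg.Build R presalg pres_cstC.

Lemma pi_aeval (t : aterm) : \pi_presalg t = aeval pres_gen t.
Proof.
elim: t => //= s <- t <-.
  by rewrite [RHS]pres_addE.
by rewrite [RHS]pres_mulE.
Qed.

Lemma presalg_ind (P : presalg -> Prop) :
    (forall r : R, P (in_pzalg r)) -> (forall i, P (pres_gen i)) ->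
    (forall x y, P x -> P y -> P (x + y)) ->
    (forall x y, P x -> P y -> P (x * y)) ->
  forall x, P x.
Proof.
move=> Pc Pg PD PM; elim/quotW => t; rewrite pi_aeval.
by elim: t => //= s Ps t Pt; [exact: PD | exact: PM].
Qed.

Section UniversalProperty.
Variables (A : pzAlgType R) (g : X -> A).
Hypothesis grel : forall s t, rel s t -> aeval g s = aeval g t.

Lemma aeval_acong (s t : aterm) : acong s t -> aeval g s = aeval g t.
Proof.
elim=> {s t} /=; first by [].
- by [].
- by move=> s t u _ -> _ ->.
- by move=> s s' t t' _ -> _ ->.
- by move=> s s' t t' _ -> _ ->.
- by move=> s t u; rewrite addrA.
- by move=> s t; rewrite addrC.
- by move=> s; rewrite rmorph0 add0r.
- by move=> s; rewrite rmorphN1 rmorph0 mulN1r addNr.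
- by move=> s t u; rewrite mulrA.
- by move=> s; rewrite rmorph1 mul1r.
- by move=> s; rewrite rmorph1 mulr1.
- by move=> s t u; rewrite mulrDl.
- by move=> s t u; rewrite mulrDr.
- by move=> r r'; rewrite rmorphD.
- by move=> r r'; rewrite rmorphM.
- by move=> r s; rewrite in_pzalgC.
- exact: grel.
Qed.

Definition pres_lift of (forall s t, rel s t -> aeval g s = aeval g t) :=
  fun x : presalg => aeval g (repr x).

Local Notation lift := (pres_lift grel).

Lemma pres_lift_pi (t : aterm) : lift (\pi t) = aeval g t.
Proof. exact/aeval_acong/presalg_reprP. Qed.

Lemma pres_lift_gen (i : X) : lift (pres_gen i) = g i.
Proof. exact: pres_lift_pi. Qed.

Fact pres_lift_is_nmod_morphism : nmod_morphism lift.
Proof.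
split; first by rewrite [LHS]pres_lift_pi /= rmorph0.
by elim/quotW=> s; elim/quotW=> t; rewrite [_ + _]pres_addE !pres_lift_pi.
Qed.

Fact pres_lift_is_monoid_morphism : monoid_morphism lift.
Proof.
split; first by rewrite [LHS]pres_lift_pi /= rmorph1.
by elim/quotW=> s; elim/quotW=> t; rewrite [_ * _]pres_mulE !pres_lift_pi.
Qed.

Fact pres_lift_in_pzalg (r : R) : lift (in_pzalg r) = in_pzalg r.
Proof. exact: pres_lift_pi. Qed.

HB.instance Definition _ :=
  GRing.isNmodMorphism.Build presalg A lift pres_lift_is_nmod_morphism.
HB.instance Definition _ :=
  GRing.isMonoidMorphism.Build presalg A lift pres_lift_is_monoid_morphism.
HB.instance Definition _ :=
  isAlgHom.Build R presalg A lift pres_lift_in_pzalg.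

End UniversalProperty.

End Presentation.

Arguments ACst {R X}.
Arguments AGen {R X}.
Arguments AAdd {R X}.
Arguments AMul {R X}.

(* The balanced tensor product of X and Y over a set S of scalars acting on X
   from the right and on Y from the left: the quotient of the free abelian
   group on X * Y by biadditivity and by r x s # y ~ x # l s y. *)
Section Tensor.
Variables (S : Type) (X Y : zmodType) (r : X -> S -> X) (l : S -> Y -> Y).

Inductive tterm : Type :=
  | TPure of X & Y
  | TZero
  | TOpp of tterm
  | TAdd of tterm & tterm.

HB.instance Definition _ := gen_eqMixin tterm.
HB.instance Definition _ := gen_choiceMixin tterm.

Fixpoint teval (Z : zmodType) (f : X -> Y -> Z) (t : tterm) : Z :=
  match t with
  | TPure x y => f x y
  | TZero => 0
  | TOpp t => - teval f t
  | TAdd s t => teval f s + teval f t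
  end.

Inductive tcong : tterm -> tterm -> Prop :=
  | tcong_refl s : tcong s s
  | tcong_sym s t : tcong s t -> tcong t s
  | tcong_trans s t u : tcong s t -> tcong t u -> tcong s u
  | tcong_opp s t : tcong s t -> tcong (TOpp s) (TOpp t)
  | tcong_add s s' t t' : tcong s s' -> tcong t t' ->
      tcong (TAdd s t) (TAdd s' t')
  | tcong_addA s t u : tcong (TAdd s (TAdd t u)) (TAdd (TAdd s t) u)
  | tcong_addC s t : tcong (TAdd s t) (TAdd t s)
  | tcong_add0 s : tcong (TAdd TZero s) s
  | tcong_addN s : tcong (TAdd (TOpp s) s) TZero
  | tcong_pureDl x x' y :
      tcong (TPure (x + x') y) (TAdd (TPure x y) (TPure x' y))
  | tcong_pureDr x y y' :
      tcong (TPure x (y + y')) (TAdd (TPure x y) (TPure x y'))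
  | tcong_bal x s y : tcong (TPure (r x s) y) (TPure x (l s y)).

Definition tcongb (s t : tterm) : bool := `[< tcong s t >].

Fact tcongb_equiv : equiv_class_of tcongb.
Proof.
split=> [s|s t|t s u].
- by apply/asboolP; exact: tcong_refl.
- by apply/asboolP/asboolP; exact: tcong_sym.
- by move=> /asboolP st /asboolP tu; apply/asboolP; exact: tcong_trans tu.
Qed.

Canonical tcongb_equiv_rel := EquivRelPack tcongb_equiv.

Definition tens : Type := {eq_quot tcongb}.
HB.instance Definition _ := Choice.on tens.
HB.instance Definition _ := EqQuotient.on tens.

Lemma tens_eqP (s t : tterm) :
  reflect (\pi_tens s = \pi_tens t) (tcongb s t).
Proof. exact: eqmodP. Qed.

Lemma tens_pi_eq (s t : tterm) : tcong s t -> \pi_tens s = \pi_tens t.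
Proof. by move=> st; apply/tens_eqP/asboolP. Qed.

Lemma tens_reprP (s : tterm) : tcong (repr (\pi_tens s)) s.
Proof. by apply/asboolP/tens_eqP; rewrite reprK. Qed.

Definition tens_pure (x : X) (y : Y) : tens := \pi_tens (TPure x y).
Definition tens_zero : tens := \pi_tens TZero.
Definition tens_opp (x : tens) : tens := \pi_tens (TOpp (repr x)).
Definition tens_add (x y : tens) : tens := \pi_tens (TAdd (repr x) (repr y)).

Lemma tens_addE s t : tens_add (\pi s) (\pi t) = \pi_tens (TAdd s t).
Proof. by apply/tens_pi_eq/tcong_add; exact: tens_reprP. Qed.

Lemma tens_oppE s : tens_opp (\pi s) = \pi_tens (TOpp s).
Proof. by apply/tens_pi_eq/tcong_opp; exact: tens_reprP. Qed.

Fact tens_addA : associative tens_add.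
Proof.
elim/quotW=> s; elim/quotW=> t; elim/quotW=> u.
by rewrite !tens_addE; exact/tens_pi_eq/tcong_addA.
Qed.

Fact tens_addC : commutative tens_add.
Proof.
elim/quotW=> s; elim/quotW=> t.
by rewrite !tens_addE; exact/tens_pi_eq/tcong_addC.
Qed.

Fact tens_add0 : left_id tens_zero tens_add.
Proof. by elim/quotW=> s; rewrite tens_addE; exact/tens_pi_eq/tcong_add0. Qed.

Fact tens_addN : left_inverse tens_zero tens_opp tens_add.
Proof.
elim/quotW=> s; rewrite tens_oppE tens_addE.
exact/tens_pi_eq/tcong_addN.
Qed.

HB.instance Definition _ :=
  GRing.isZmodule.Build tens tens_addA tens_addC tens_add0 tens_addN.

Lemma tens_pureDl x x' y :
  tens_pure (x + x') y = tens_pure x y + tens_pure x' y.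
Proof. by rewrite [RHS]tens_addE; exact/tens_pi_eq/tcong_pureDl. Qed.

Lemma tens_pureDr x y y' :
  tens_pure x (y + y') = tens_pure x y + tens_pure x y'.
Proof. by rewrite [RHS]tens_addE; exact/tens_pi_eq/tcong_pureDr. Qed.

Lemma tens_bal x s y : tens_pure (r x s) y = tens_pure x (l s y).
Proof. exact/tens_pi_eq/tcong_bal. Qed.

Lemma tens_ind (P : tens -> Prop) :
    (forall x y, P (tens_pure x y)) -> P 0 ->
    (forall t, P t -> P (- t)) ->
    (forall s t, P s -> P t -> P (s + t)) ->
  forall t, P t.
Proof.
move=> Pp P0 PN PD; elim/quotW; elim=> //= [t Pt|s Ps t Pt].
- by move: (PN _ Pt); rewrite [- _]tens_oppE.
- by move: (PD _ _ Ps Pt); rewrite [_ + _]tens_addE.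
Qed.

Record tens_bilin (Z : zmodType) (f : X -> Y -> Z) : Prop := TensBilin {
  tens_bilinDl : forall x x' y, f (x + x') y = f x y + f x' y;
  tens_bilinDr : forall x y y', f x (y + y') = f x y + f x y';
  tens_bilin_bal : forall x s y, f (r x s) y = f x (l s y)
}.

Lemma tens_pure_bilin : tens_bilin tens_pure.
Proof. by split; [exact: tens_pureDl|exact: tens_pureDr|exact: tens_bal]. Qed.

Section UniversalProperty.
Variables (Z : zmodType) (f : X -> Y -> Z).
Hypothesis fbil : tens_bilin f.

Lemma teval_tcong (s t : tterm) : tcong s t -> teval f s = teval f t.
Proof.
elim=> {s t} /=; first by [].
- by [].
- by move=> s t u _ -> _ ->.
- by move=> s t _ ->.
- by move=> s s' t t' _ -> _ ->.
- by move=> s t u; rewrite addrA.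
- by move=> s t; rewrite addrC.
- by move=> s; rewrite add0r.
- by move=> s; rewrite addNr.
- exact: tens_bilinDl fbil.
- exact: tens_bilinDr fbil.
- exact: tens_bilin_bal fbil.
Qed.

Definition tens_lift of tens_bilin f := fun x : tens => teval f (repr x).

Local Notation lift := (tens_lift fbil).

Lemma tens_lift_pi (t : tterm) : lift (\pi_tens t) = teval f t.
Proof. exact/teval_tcong/tens_reprP. Qed.

Lemma tens_lift_pure x y : lift (tens_pure x y) = f x y.
Proof. exact: tens_lift_pi. Qed.

Fact tens_lift_is_nmod_morphism : nmod_morphism lift.
Proof.
split; first exact: tens_lift_pi.
by elim/quotW=> s; elim/quotW=> t; rewrite [_ + _]tens_addE !tens_lift_pi.
Qed.

HB.instance Definition _ :=
  GRing.isNmodMorphism.Build tens Z lift tens_lift_is_nmod_morphism.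

End UniversalProperty.

Lemma tens_ext (Z : zmodType) (f g : {additive tens -> Z}) :
  (forall x y, f (tens_pure x y) = g (tens_pure x y)) -> f =1 g.
Proof.
move=> fg; elim/tens_ind => [x y||t IHt|s t IHs IHt].
- exact: fg.
- by rewrite !raddf0.
- by rewrite !raddfN IHt.
- by rewrite !raddfD IHs IHt.
Qed.

End Tensor.

(* M (x) N over R, for modules M and N over R-algebras A and B. *)
Section ModuleTensor.
Variables (R : comPzRingType) (A B : pzAlgType R).

Definition mtens (M : lmodType A) (N : lmodType B) : Type :=
  tens (fun (x : M) (s : R) => in_pzalg s *: x)
       (fun (s : R) (y : N) => in_pzalg s *: y).

HB.instance Definition _ M N := GRing.Zmodule.on (mtens M N).

Definition mpure (M : lmodType A) (N : lmodType B) (x : M) (y : N) :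
  mtens M N := tens_pure _ _ x y.

Lemma mtens_ext (M : lmodType A) (N : lmodType B) (Z : zmodType)
    (f g : {additive mtens M N -> Z}) :
  (forall x y, f (mpure x y) = g (mpure x y)) -> f =1 g.
Proof. exact: tens_ext. Qed.

Definition talg : Type := mtens A^o B^o.
HB.instance Definition _ := GRing.Zmodule.on talg.
Definition tpure (x : A) (y : B) : talg := mpure (x : A^o) (y : B^o).

Section Action.
Variables (M : lmodType A) (N : lmodType B).

Fact mact1_bilin (x : A) (y : B) :
  tens_bilin (fun (u : M) (s : R) => in_pzalg s *: u)
             (fun (s : R) (v : N) => in_pzalg s *: v)
             (fun u v => mpure (x *: u) (y *: v)).
Proof.
split=> [u u' v|u v v'|u s v].
- by rewrite scalerDr; exact: tens_pureDl.
- by rewrite scalerDr; exact: tens_pureDr.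
- rewrite !scalerA -!in_pzalgC -!scalerA; exact: tens_bal.
Qed.

Definition mact1 (x : A) (y : B) : mtens M N -> mtens M N :=
  tens_lift (mact1_bilin x y).

Lemma mact1_pure x y u v : mact1 x y (mpure u v) = mpure (x *: u) (y *: v).
Proof. exact: tens_lift_pure. Qed.

HB.instance Definition _ x y :=
  GRing.Additive.copy (mact1 x y) (tens_lift (mact1_bilin x y)).

Fact mact_bilin :
  tens_bilin (fun (x : A^o) (s : R) => (in_pzalg s : A) *: x)
             (fun (s : R) (y : B^o) => (in_pzalg s : B) *: y)
             (fun x y => mact1 x y).
Proof.
split=> [x x' y|x y y'|x s y]; apply/funext => t.
- rewrite -[RHS]/(mact1 x y t + mact1 x' y t).
  rewrite -[RHS]/((mact1 x y \+ mact1 x' y) t).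
  apply: (mtens_ext (f := mact1 (x + x') y) (g := mact1 x y \+ mact1 x' y)).
  move=> u v /=; rewrite !mact1_pure scalerDl; exact: tens_pureDl.
- rewrite -[RHS]/((mact1 x y \+ mact1 x y') t).
  apply: (mtens_ext (f := mact1 x (y + y')) (g := mact1 x y \+ mact1 x y')).
  move=> u v /=; rewrite !mact1_pure scalerDl; exact: tens_pureDr.
- apply: (mtens_ext (f := mact1 (in_pzalg s * x) y)
                    (g := mact1 x (in_pzalg s * y))).
  move=> u v /=; rewrite !mact1_pure -!scalerA; exact: tens_bal.
Qed.

(* The action (x # y) (u # v) = x u # y v of A (x) B on M (x) N. *)
Definition mact : talg -> mtens M N -> mtens M N := tens_lift mact_bilin.

HB.instance Definition _ :=
  GRing.Additive.copy mact (tens_lift mact_bilin).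

Lemma mact_pure x y u v :
  mact (tpure x y) (mpure u v) = mpure (x *: u) (y *: v).
Proof. by rewrite /mact tens_lift_pure mact1_pure. Qed.

Fact mact_is_nmod_morphism (t : talg) : nmod_morphism (mact t).
Proof.
elim/tens_ind: t => [x y||t [t0 tD]|s t [s0 sD] [t0 tD]].
- by rewrite /mact tens_lift_pure; split; [exact: raddf0|exact: raddfD].
- by rewrite raddf0; split=> [|u v] //; rewrite -[RHS]/(0 + 0) addr0.
- rewrite raddfN; split=> [|u v].
    by rewrite -[LHS]/(- mact t 0) t0 oppr0.
  by rewrite -[LHS]/(- mact t (u + v)) tD opprD.
- rewrite raddfD; split=> [|u v].
    by rewrite -[LHS]/(mact s 0 + mact t 0) s0 t0 addr0.
  by rewrite -[LHS]/(mact s (u + v) + mact t (u + v)) sD tD addrACA.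
Qed.

Lemma mact0r t : mact t 0 = 0.
Proof. by case: (mact_is_nmod_morphism t). Qed.

Lemma mactDr t u v : mact t (u + v) = mact t u + mact t v.
Proof. by case: (mact_is_nmod_morphism t). Qed.

Lemma mactNr t u : mact t (- u) = - mact t u.
Proof. by apply: (addIr (mact t u)); rewrite -mactDr !addNr mact0r. Qed.

Lemma mact0l u : mact 0 u = 0.
Proof. by rewrite (raddf0 mact). Qed.

Lemma mactNl s u : mact (- s) u = - mact s u.
Proof. by rewrite (raddfN mact). Qed.

Lemma mactDl s t u : mact (s + t) u = mact s u + mact t u.
Proof. by rewrite (raddfD mact). Qed.

End Action.

Lemma mtens_ind (M : lmodType A) (N : lmodType B) (P : mtens M N -> Prop) :
    (forall x y, P (mpure x y)) -> P 0 -> (forall t, P t -> P (- t)) ->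
    (forall s t, P s -> P t -> P (s + t)) ->
  forall t, P t.
Proof. exact: tens_ind. Qed.

Lemma talg_ind (P : talg -> Prop) :
    (forall x y, P (tpure x y)) -> P 0 -> (forall t, P t -> P (- t)) ->
    (forall s t, P s -> P t -> P (s + t)) ->
  forall t, P t.
Proof. exact: tens_ind. Qed.

Definition tone : talg := tpure 1 1.
Definition tmul : talg -> talg -> talg := @mact A^o B^o.

Lemma mact1l (M : lmodType A) (N : lmodType B) (u : mtens M N) :
  mact tone u = u.
Proof.
elim/mtens_ind: u => [x y||u IHu|u v IHu IHv].
- by rewrite mact_pure !scale1r.
- by rewrite mact0r.
- by rewrite mactNr IHu.
- by rewrite mactDr IHu IHv.
Qed.

Lemma mactA (M : lmodType A) (N : lmodType B) s t (u : mtens M N) :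
  mact (tmul s t) u = mact s (mact t u).
Proof.
elim/talg_ind: s => [x y||s IHs|s s' IHs IHs'].
- elim/talg_ind: t => [x' y'||t IHt|t t' IHt IHt'].
  + elim/mtens_ind: u => [v w||u IHu|u u' IHu IHu'].
    * rewrite !mact_pure !scalerA -mact_pure.
      by congr mact; exact: mact_pure.
    * by rewrite !mact0r.
    * by rewrite !mactNr IHu.
    * by rewrite !mactDr IHu IHu'.
  + by rewrite /tmul mact0r !mact0l mact0r.
  + by rewrite /tmul mactNr !mactNl mactNr IHt.
  + by rewrite /tmul mactDr !mactDl mactDr IHt IHt'.
- by rewrite /tmul !mact0l.
- by rewrite /tmul !mactNl -IHs.
- by rewrite /tmul !mactDl -IHs -IHs'.
Qed.

Fact tmulA : associative tmul.
Proof. by move=> s t u; rewrite [RHS]mactA. Qed.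

Fact tmul1l : left_id tone tmul.
Proof. exact: mact1l. Qed.

Fact tmul1r : right_id tone tmul.
Proof.
elim/talg_ind => [x y||t IHt|s t IHs IHt].
- rewrite [LHS]mact_pure; congr mpure; exact: mulr1.
- exact: mact0l.
- by rewrite /tmul mactNl -[in RHS]IHt.
- by rewrite /tmul mactDl -[in RHS]IHs -[in RHS]IHt.
Qed.

Fact tmulDl : left_distributive tmul +%R.
Proof. by move=> s t u; exact: mactDl. Qed.

Fact tmulDr : right_distributive tmul +%R.
Proof. by move=> s t u; exact: mactDr. Qed.

HB.instance Definition _ := GRing.Zmodule_isPzRing.Build talg
  tmulA tmul1l tmul1r tmulDl tmulDr.

Lemma tpure_mul x y x' y' :
  tpure x y * tpure x' y' = tpure (x * x') (y * y').
Proof. exact: mact_pure. Qed.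

Lemma tpure1 : tpure 1 1 = 1. Proof. by []. Qed.

Definition in_talg (r : R) : talg := tpure (in_pzalg r) 1.

Fact in_talg_is_zmod_morphism : zmod_morphism in_talg.
Proof.
move=> r s; apply/eqP; rewrite eq_sym subr_eq -[X in _ == X]tens_pureDl.
by rewrite -rmorphD subrK.
Qed.

Fact in_talg_is_monoid_morphism : monoid_morphism in_talg.
Proof.
split=> [|r s]; first by rewrite /in_talg rmorph1.
by rewrite /in_talg tpure_mul rmorphM mulr1.
Qed.

HB.instance Definition _ :=
  GRing.isZmodMorphism.Build R talg in_talg in_talg_is_zmod_morphism.
HB.instance Definition _ :=
  GRing.isMonoidMorphism.Build R talg in_talg in_talg_is_monoid_morphism.

Fact in_talgC (r : R) (t : talg) : in_talg r * t = t * in_talg r.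
Proof.
elim/talg_ind: t => [x y||t IHt|s t IHs IHt].
- by rewrite !tpure_mul mulr1 mul1r in_pzalgC.
- by rewrite mulr0 mul0r.
- by rewrite mulrN mulNr IHt.
- by rewrite mulrDl mulrDr IHs IHt.
Qed.

HB.instance Definition _ := PzRing_isAlg.Build R talg in_talgC.

HB.instance Definition _ (M : lmodType A) (N : lmodType B) :=
  GRing.Zmodule_isLmodule.Build talg (mtens M N)
    (fun s t u => esym (mactA s t u)) (@mact1l M N)
    (fun t => mactDr t) (fun u s t => mactDl s t u).

Lemma mtens_scale_pure (M : lmodType A) (N : lmodType B) x y (u : M) (v : N) :
  tpure x y *: mpure u v = mpure (x *: u) (y *: v).
Proof. exact: mact_pure. Qed.

Section UniversalProperty.
Variables (C : pzAlgType R) (f : {alghom A -> C}) (g : {alghom B -> C}).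

Definition commuting_images := forall x y, f x * g y = g y * f x.

Hypothesis fgC : commuting_images.

Fact talg_lift_bilin :
  tens_bilin (fun (x : A^o) (s : R) => (in_pzalg s : A) *: x)
             (fun (s : R) (y : B^o) => (in_pzalg s : B) *: y)
             (fun x y => f x * g y).
Proof.
split=> [x x' y|x y y'|x s y].
- by rewrite rmorphD mulrDl.
- by rewrite rmorphD mulrDr.
- change (f (in_pzalg s * x) * g y = f x * g (in_pzalg s * y)).
  by rewrite !rmorphM /= !alghom_in_pzalg mulrA in_pzalgC.
Qed.

Definition talg_lift of commuting_images : talg -> C :=
  tens_lift talg_lift_bilin.

Local Notation lift := (talg_lift fgC).

HB.instance Definition _ :=
  GRing.Additive.copy lift (tens_lift talg_lift_bilin).

Lemma talg_lift_pure x y : lift (tpure x y) = f x * g y.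
Proof. exact: tens_lift_pure. Qed.

Fact talg_lift_is_monoid_morphism : monoid_morphism lift.
Proof.
split=> [|s t]; first by rewrite -tpure1 talg_lift_pure !rmorph1 mulr1.
elim/talg_ind: s => [x y||s IHs|s s' IHs IHs'].
- elim/talg_ind: t => [x' y'||t IHt|t t' IHt IHt'].
  + rewrite tpure_mul !talg_lift_pure !rmorphM -!mulrA.
    by congr (_ * _); rewrite !mulrA fgC.
  + by rewrite !(mulr0, raddf0).
  + by rewrite mulrN !raddfN /= mulrN IHt.
  + by rewrite mulrDr !raddfD /= mulrDr IHt IHt'.
- by rewrite !(mul0r, raddf0).
- by rewrite mulNr !raddfN /= mulNr IHs.
- by rewrite mulrDl !raddfD /= mulrDl IHs IHs'.
Qed.

HB.instance Definition _ :=
  GRing.isMonoidMorphism.Build talg C lift talg_lift_is_monoid_morphism.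

Fact talg_lift_in_pzalg (r : R) : lift (in_pzalg r) = in_pzalg r.
Proof.
by rewrite [LHS]talg_lift_pure rmorph1 mulr1 alghom_in_pzalg.
Qed.

HB.instance Definition _ := isAlgHom.Build R talg C lift talg_lift_in_pzalg.

End UniversalProperty.

Section Inclusions.

Definition tinl (x : A) : talg := tpure x 1.
Definition tinr (y : B) : talg := tpure 1 y.

Fact tinl_is_zmod_morphism : zmod_morphism tinl.
Proof.
move=> x y; apply/eqP; rewrite eq_sym subr_eq -[X in _ == X]tens_pureDl.
by rewrite subrK.
Qed.

Fact tinr_is_zmod_morphism : zmod_morphism tinr.
Proof.
move=> x y; apply/eqP; rewrite eq_sym subr_eq -[X in _ == X]tens_pureDr.
by rewrite subrK.
Qed.

Fact tinl_is_monoid_morphism : monoid_morphism tinl.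
Proof. by split=> // x y; rewrite tpure_mul mulr1. Qed.

Fact tinr_is_monoid_morphism : monoid_morphism tinr.
Proof. by split=> // x y; rewrite tpure_mul mulr1. Qed.

Fact tinl_in_pzalg (r : R) : tinl (in_pzalg r) = in_pzalg r.
Proof. by []. Qed.

Fact tinr_in_pzalg (r : R) : tinr (in_pzalg r) = in_pzalg r.
Proof.
rewrite -[RHS]/(tpure (in_pzalg r) 1) -[in RHS](mulr1 (in_pzalg r)).
rewrite -[in LHS](mulr1 (in_pzalg r)); symmetry; exact: tens_bal.
Qed.

HB.instance Definition _ :=
  GRing.isZmodMorphism.Build A talg tinl tinl_is_zmod_morphism.
HB.instance Definition _ :=
  GRing.isMonoidMorphism.Build A talg tinl tinl_is_monoid_morphism.
HB.instance Definition _ := isAlgHom.Build R A talg tinl tinl_in_pzalg.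
HB.instance Definition _ :=
  GRing.isZmodMorphism.Build B talg tinr tinr_is_zmod_morphism.
HB.instance Definition _ :=
  GRing.isMonoidMorphism.Build B talg tinr tinr_is_monoid_morphism.
HB.instance Definition _ := isAlgHom.Build R B talg tinr tinr_in_pzalg.

Lemma tinlr_comm (x : A) (y : B) : tinl x * tinr y = tinr y * tinl x.
Proof. by rewrite !tpure_mul !(mul1r, mulr1). Qed.

Lemma tpureE (x : A) (y : B) : tpure x y = tinl x * tinr y.
Proof. by rewrite tpure_mul mul1r mulr1. Qed.

End Inclusions.
End ModuleTensor.

Notation "M \otimes N" := (mtens M N) (at level 40, left associativity).

Section Isomorphism.
Variable A : pzRingType.

Definition lmod_iso (U V : lmodType A) : Prop :=
  exists f : {linear U -> V}, bijective f.

Definition free_of_finite_rank (V : lmodType A) : Prop :=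
  exists (k : nat) (e : 'I_k -> V),
    forall v : V, exists! c : {ffun 'I_k -> A}, v = \sum_(i < k) c i *: e i.

End Isomorphism.

(* mu[V]: the action is that of mu b, see twist_scaleE. *)
Definition twist (A B : pzRingType) (mu : {rmorphism B -> A})
  (V : lmodType A) : Type := V.

Section Twist.
Variables (A B : pzRingType) (mu : {rmorphism B -> A}).

Section Module.
Variable V : lmodType A.
Local Notation twist := (twist mu).

HB.instance Definition _ := GRing.Zmodule.on (twist V).

Definition twist_scale (x : B) (v : twist V) : twist V := mu x *: (v : V).

Fact twist_scaleA x y v :
  twist_scale x (twist_scale y v) = twist_scale (x * y) v.
Proof. by rewrite /twist_scale scalerA rmorphM. Qed.

Fact twist_scale1 : left_id 1 twist_scale.
Proof. by move=> v; rewrite /twist_scale rmorph1 scale1r. Qed.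

Fact twist_scaleDr : right_distributive twist_scale +%R.
Proof. by move=> x u v; exact: scalerDr. Qed.

Fact twist_scaleDl v : {morph twist_scale^~ v : x y / x + y}.
Proof. by move=> x y; rewrite /twist_scale rmorphD scalerDl. Qed.

HB.instance Definition _ := GRing.Zmodule_isLmodule.Build B (twist V)
  twist_scaleA twist_scale1 twist_scaleDr twist_scaleDl.

Lemma twist_scaleE x (v : V) : x *: (v : twist V) = mu x *: v :> V.
Proof. by []. Qed.

End Module.

(* A (x)_B N, with b acting on A by right multiplication by mu b. When mu is
   the inclusion of a subalgebra, this is the induced module. *)
Definition induced (N : lmodType B) : Type :=
  tens (fun (x : A) (b : B) => x * mu b) (fun (b : B) (y : N) => b *: y).

Section Induced.
Variable N : lmodType B.

HB.instance Definition _ := GRing.Zmodule.on (induced N).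

Definition ipure (x : A) (y : N) : induced N := tens_pure _ _ x y.

Lemma induced_ext (Z : zmodType) (f g : {additive induced N -> Z}) :
  (forall x y, f (ipure x y) = g (ipure x y)) -> f =1 g.
Proof. exact: tens_ext. Qed.

Lemma induced_ind (P : induced N -> Prop) :
    (forall x y, P (ipure x y)) -> P 0 -> (forall t, P t -> P (- t)) ->
    (forall s t, P s -> P t -> P (s + t)) ->
  forall t, P t.
Proof. exact: tens_ind. Qed.

Fact induced_scale_bilin (a : A) :
  tens_bilin (fun (x : A) (b : B) => x * mu b) (fun (b : B) (y : N) => b *: y)
             (fun x y => ipure (a * x) y).
Proof.
split=> [x x' y|x y y'|x b y].
- by rewrite mulrDr; exact: tens_pureDl.
- exact: tens_pureDr.
- rewrite mulrA; exact: tens_bal.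
Qed.

Definition induced_scale (a : A) : induced N -> induced N :=
  tens_lift (induced_scale_bilin a).

HB.instance Definition _ a :=
  GRing.Additive.copy (induced_scale a) (tens_lift (induced_scale_bilin a)).

Lemma induced_scale_pure a x y : induced_scale a (ipure x y) = ipure (a * x) y.
Proof. exact: tens_lift_pure. Qed.

Fact induced_scaleA a b t :
  induced_scale a (induced_scale b t) = induced_scale (a * b) t.
Proof.
apply: (induced_ext (f := induced_scale a \o induced_scale b)) => x y /=.
by rewrite !induced_scale_pure mulrA.
Qed.

Fact induced_scale1 : left_id 1 induced_scale.
Proof.
apply: (induced_ext (f := induced_scale 1) (g := idfun)) => x y /=.
by rewrite induced_scale_pure mul1r.
Qed.

Fact induced_scaleDr : right_distributive induced_scale +%R.
Proof. by move=> a s t; exact: raddfD. Qed.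

Fact induced_scaleDl t : {morph induced_scale^~ t : a b / a + b}.
Proof.
move=> a b.
apply: (induced_ext (g := induced_scale a \+ induced_scale b)) => x y /=.
by rewrite !induced_scale_pure mulrDl; exact: tens_pureDl.
Qed.

HB.instance Definition _ := GRing.Zmodule_isLmodule.Build A (induced N)
  induced_scaleA induced_scale1 induced_scaleDr induced_scaleDl.

Lemma ipure_scale a x y : a *: ipure x y = ipure (a * x) y.
Proof. exact: induced_scale_pure. Qed.

End Induced.
End Twist.

Section Dual.
Variables (R : comPzRingType) (A : pzAlgType R).

(* The R-module underlying an A-module. *)
Definition basemod (V : lmodType A) : lmodType R :=
  twist (@in_pzalg R A) V.

Definition is_functional (V : lmodType A) (f : V -> R) : bool :=
  `[< linear (f : basemod V -> R^o) >].

(* nu[V] on Hom_R(V, R), see dual_twist_scaleE; a ring morphism B -> A^c is a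
   ring anti-morphism B -> A. *)
Definition dual_twist (B : pzRingType) (nu : {rmorphism B -> A^c})
  (V : lmodType A) : Type := {f : V -> R | is_functional f}.

Section Module.
Variables (B : pzRingType) (nu : {rmorphism B -> A^c}) (V : lmodType A).
Local Notation dual_twist := (dual_twist nu).

HB.instance Definition _ := Choice.on (dual_twist V).

Lemma functional_linear (f : dual_twist V) :
  linear (val f : basemod V -> R^o).
Proof. by apply/asboolP; case: f. Qed.

Lemma functional_ext (f g : dual_twist V) :
  (forall v, val f v = val g v) -> f = g.
Proof. by move=> fg; apply/val_inj/funext. Qed.

Fact functional_zero : is_functional (fun _ : V => 0).
Proof. by apply/asboolP => r u v; rewrite scaler0 addr0. Qed.

Fact functional_opp (f : dual_twist V) : is_functional (fun v => - val f v).
Proof.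
by apply/asboolP => r u v; rewrite functional_linear opprD scalerN.
Qed.

Fact functional_add (f g : dual_twist V) :
  is_functional (fun v => val f v + val g v).
Proof.
apply/asboolP => r u v.
by rewrite !functional_linear scalerDr addrACA.
Qed.

Fact functional_scale (b : B) (f : dual_twist V) :
  is_functional (fun v => val f ((nu b : A) *: v)).
Proof.
apply/asboolP => r u v; rewrite -functional_linear; congr (val f _).
rewrite scalerDr; congr (_ + _).
by rewrite !twist_scaleE !scalerA in_pzalgC.
Qed.

Local Notation functional := (exist (fun f : V -> R => is_functional f) _).

Definition dual_zero : dual_twist V := functional functional_zero.
Definition dual_opp f : dual_twist V := functional (functional_opp f).
Definition dual_add f g : dual_twist V := functional (functional_add f g).
Definition dual_scale b f : dual_twist V :=
  functional (functional_scale b f).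

Fact dual_addA : associative dual_add.
Proof. by move=> f g h; apply: functional_ext => v /=; rewrite addrA. Qed.

Fact dual_addC : commutative dual_add.
Proof. by move=> f g; apply: functional_ext => v /=; rewrite addrC. Qed.

Fact dual_add0 : left_id dual_zero dual_add.
Proof. by move=> f; apply: functional_ext => v /=; rewrite add0r. Qed.

Fact dual_addN : left_inverse dual_zero dual_opp dual_add.
Proof. by move=> f; apply: functional_ext => v /=; rewrite addNr. Qed.

HB.instance Definition _ :=
  GRing.isZmodule.Build (dual_twist V) dual_addA dual_addC dual_add0 dual_addN.

Lemma functionalD (f : dual_twist V) (u v : V) :
  val f (u + v) = val f u + val f v.
Proof.
have := functional_linear f 1 u v.
by rewrite !scale1r.
Qed.

Fact dual_scaleA b c f : dual_scale b (dual_scale c f) = dual_scale (b * c) f.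
Proof.
by apply: functional_ext => v /=; rewrite scalerA (rmorphM nu).
Qed.

Fact dual_scale1 : left_id 1 dual_scale.
Proof. by move=> f; apply: functional_ext => v /=; rewrite rmorph1 scale1r. Qed.

Fact dual_scaleDr : right_distributive dual_scale +%R.
Proof. by move=> b f g; exact: functional_ext. Qed.

Fact dual_scaleDl f : {morph dual_scale^~ f : b c / b + c}.
Proof.
move=> b c; apply: functional_ext => v /=.
by rewrite (rmorphD nu) scalerDl functionalD.
Qed.

HB.instance Definition _ := GRing.Zmodule_isLmodule.Build B (dual_twist V)
  dual_scaleA dual_scale1 dual_scaleDr dual_scaleDl.

Lemma dual_twist_scaleE (b : B) (f : dual_twist V) (v : V) :
  val (b *: f) v = val f ((nu b : A) *: v).
Proof. by []. Qed.

End Module.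
End Dual.

Section ConverseHom.
Variables (R : comPzRingType) (A B : pzAlgType R) (f : {alghom A -> B}).

Definition conv_hom : A^c -> B^c := f.

Fact conv_hom_is_zmod_morphism : zmod_morphism conv_hom.
Proof. exact: (rmorphB f). Qed.

Fact conv_hom_is_monoid_morphism : monoid_morphism conv_hom.
Proof. by split=> [|x y]; [exact: (rmorph1 f)|exact: (rmorphM f)]. Qed.

Fact conv_hom_in_pzalg (r : R) : conv_hom (in_pzalg r) = in_pzalg r.
Proof. exact (@alghom_in_pzalg R A B f r). Qed.

HB.instance Definition _ :=
  GRing.isZmodMorphism.Build A^c B^c conv_hom conv_hom_is_zmod_morphism.
HB.instance Definition _ :=
  GRing.isMonoidMorphism.Build A^c B^c conv_hom conv_hom_is_monoid_morphism.
HB.instance Definition _ :=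
  isAlgHom.Build R A^c B^c conv_hom conv_hom_in_pzalg.

End ConverseHom.

(* The indices 1, ..., n - 1 of the generators of H_n. *)
Definition hidx (n : nat) : Type := {i : nat | (0 < i < n)%N}.

Section Hecke.
Variables (R : comPzRingType) (a b : R).
Implicit Types m n p : nat.

Inductive hecke_rel n : aterm R (hidx n) -> aterm R (hidx n) -> Prop :=
  | hecke_rel_quad i :
      hecke_rel (AMul (AGen i) (AGen i))
                (AAdd (AMul (ACst a) (AGen i)) (ACst b))
  | hecke_rel_braid i j : val j = (val i).+1 ->
      hecke_rel (AMul (AMul (AGen i) (AGen j)) (AGen i))
                (AMul (AMul (AGen j) (AGen i)) (AGen j))
  | hecke_rel_comm i j : ((val i).+2 <= val j)%N || ((val j).+2 <= val i)%N ->
      hecke_rel (AMul (AGen i) (AGen j)) (AMul (AGen j) (AGen i)).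

Definition hecke n : Type := presalg (@hecke_rel n).
HB.instance Definition _ n := PzAlg.on (hecke n).

Definition hpi n (i : hidx n) : hecke n := pres_gen (@hecke_rel n) i.

Record hecke_family n (A : pzAlgType R) (g : hidx n -> A) : Prop :=
  HeckeFamily {
    hecke_quad : forall i, g i * g i = in_pzalg a * g i + in_pzalg b;
    hecke_braid : forall i j, val j = (val i).+1 ->
      g i * g j * g i = g j * g i * g j;
    hecke_comm : forall i j,
      ((val i).+2 <= val j)%N || ((val j).+2 <= val i)%N ->
      g i * g j = g j * g i
  }.

Fact hecke_family_rel n (A : pzAlgType R) (g : hidx n -> A) :
  hecke_family g -> forall s t, hecke_rel s t -> aeval g s = aeval g t.
Proof.
move=> [gq gb gc] _ _ [i|i j|i j] /=; [exact: gq|exact: gb|exact: gc].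
Qed.

Fact hpi_family n : hecke_family (@hpi n).
Proof.
have h s t : hecke_rel s t -> aeval (@hpi n) s = aeval (@hpi n) t.
  move=> st; rewrite -[LHS](pi_aeval (@hecke_rel n)).
  rewrite -[RHS](pi_aeval (@hecke_rel n)).
  exact/presalg_pi_eq/acong_rel.
by split=> [i|i j ij|i j ij];
  [exact: h (hecke_rel_quad i)|exact: h (hecke_rel_braid ij)|
   exact: h (hecke_rel_comm ij)].
Qed.

Definition hecke_lift n (A : pzAlgType R) (g : hidx n -> A)
  (gH : hecke_family g) : {alghom hecke n -> A} :=
  pres_lift (hecke_family_rel gH).

Lemma hecke_lift_hpi n (A : pzAlgType R) (g : hidx n -> A)
  (gH : hecke_family g) i : hecke_lift gH (hpi i) = g i.
Proof. exact: (pres_lift_gen (hecke_family_rel gH)). Qed.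

Lemma hecke_ind n (P : hecke n -> Prop) :
    (forall r : R, P (in_pzalg r)) -> (forall i, P (hpi i)) ->
    (forall x y, P x -> P y -> P (x + y)) ->
    (forall x y, P x -> P y -> P (x * y)) ->
  forall x, P x.
Proof. exact: presalg_ind. Qed.

Lemma hecke_hom_ext n (A : pzAlgType R) (f g : {alghom hecke n -> A}) :
  (forall i, f (hpi i) = g (hpi i)) -> f =1 g.
Proof.
move=> fg; elim/hecke_ind => [r|//|x y IHx IHy|x y IHx IHy].
- by rewrite !alghom_in_pzalg.
- by rewrite !rmorphD /= IHx IHy.
- by rewrite !rmorphM /= IHx IHy.
Qed.

Lemma hecke_hom_id n (f : hecke n -> hecke n) :
    (forall r, f (in_pzalg r) = in_pzalg r) -> {morph f : x y / x + y} ->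
    {morph f : x y / x * y} -> (forall i, f (hpi i) = hpi i) ->
  forall x, f x = x.
Proof.
move=> fc fD fM fg; elim/hecke_ind => // x y IHx IHy.
- by rewrite fD IHx IHy.
- by rewrite fM IHx IHy.
Qed.

Lemma hecke_commute n (A : pzAlgType R) (f : {alghom hecke n -> A}) (y : A) :
  (forall i, f (hpi i) * y = y * f (hpi i)) -> forall x, f x * y = y * f x.
Proof.
move=> fy; elim/hecke_ind => [r|//|x z IHx IHz|x z IHx IHz].
- by rewrite !alghom_in_pzalg in_pzalgC.
- by rewrite rmorphD mulrDl mulrDr /= IHx IHz.
- by rewrite rmorphM mulrA -mulrA /= IHz !mulrA IHx.
Qed.

Section Automorphisms.
Variable n : nat.

Fact rev_hidx_proof (i : hidx n) : (0 < n - val i < n)%N.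
Proof.
case/andP: (valP i) => i_gt0 i_lt; rewrite subn_gt0 i_lt /=.
by rewrite ltn_subrL i_gt0 (leq_trans _ i_lt).
Qed.

Definition rev_hidx (i : hidx n) : hidx n :=
  Sub (n - val i)%N (rev_hidx_proof i).

Fact phi_family : hecke_family (fun i => hpi (rev_hidx i)).
Proof.
have [q br c] := hpi_family n; split=> [i|i j ij|i j ij]; first exact: q.
- symmetry; apply: br => /=; rewrite ij subnS prednK // subn_gt0.
  by move: (valP j); rewrite ij => /andP[_ /ltnW].
- apply: c => /=.
  by move: ij (valP i) (valP j) => /=; case: i j => [i ?] [j ?] /=; lia.
Qed.

Definition phi : {alghom hecke n -> hecke n} := hecke_lift phi_family.

Lemma phi_hpi i : phi (hpi i) = hpi (rev_hidx i).
Proof. exact: hecke_lift_hpi. Qed.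

Fact theta_braid (A : pzAlgType R) (x y : A) :
    x * x = in_pzalg a * x + in_pzalg b ->
    y * y = in_pzalg a * y + in_pzalg b ->
    x * y * x = y * x * y ->
  let x' := in_pzalg a - x in let y' := in_pzalg a - y in
  x' * y' * x' = y' * x' * y'.
Proof.
move=> xx yy xyx /=; set c : A := in_pzalg a; set d : A := in_pzalg b.
have cC z : z * c = c * z by rewrite /c in_pzalgC.
have expand u v : u * u = c * u + d ->
    (c - u) * (c - v) * (c - u) =
    c * c * c - c * c * u + c * d - c * c * v + (c * u * v + c * v * u)
      - u * v * u.
  move=> uu; have sq : (c - u) * (c - u) = c * (c - u) + d.
    rewrite mulrBl; congr (_ + _).
    by rewrite mulrBr uu cC opprB addrAC subrr add0r.
  have -> : (c - u) * (c - v) * (c - u) =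
      c * ((c - u) * (c - u)) - (c - u) * v * (c - u).
    by rewrite [(c - u) * (c - v)]mulrBr mulrBl (cC (c - u)) mulrA.
  have -> : (c - u) * v * (c - u) =
      c * c * v - (c * u * v + c * v * u) + u * v * u.
    rewrite mulrBl mulrBr !mulrBl cC [u * v * c]cC !mulrA.
    by rewrite opprB addrA opprD addrA [RHS]addrAC addrAC.
  rewrite sq mulrDr mulrBr mulrBr !mulrA.
  by rewrite opprD [LHS]addrA; congr (_ - _); rewrite opprB [LHS]addrA addrAC.
rewrite !expand // xyx; congr (_ + _ - _); last by rewrite addrC.
by rewrite [LHS]addrAC [RHS]addrAC; congr (_ + _); rewrite addrAC.
Qed.

Fact theta_family :
  hecke_family (fun i => in_pzalg a - @hpi n i).
Proof.
have [q br c] := hpi_family n; split=> [i|i j ij|i j ij].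
- rewrite mulrBl; congr (_ + _).
  by rewrite mulrBr q -in_pzalgC opprB addrAC subrr add0r.
- exact: theta_braid (q i) (q j) (br i j ij).
- rewrite !mulrBl !mulrBr c // -(in_pzalgC a (hpi i)) -(in_pzalgC a (hpi j)).
  by rewrite !opprB [LHS]addrACA [RHS]addrACA; congr (_ + _); rewrite addrC.
Qed.

Definition theta : {alghom hecke n -> hecke n} := hecke_lift theta_family.

Lemma theta_hpi i : theta (hpi i) = in_pzalg a - hpi i.
Proof. exact: hecke_lift_hpi. Qed.

Fact chi_family : hecke_family (fun i => @hpi n i : (hecke n)^c).
Proof.
have [q br c] := hpi_family n; split=> [i|i j ij|i j ij].
- rewrite [LHS]q; congr (_ + _).
  exact (@in_pzalgC R (hecke n) a (hpi i)).
- change (hpi i * (hpi j * hpi i) = hpi j * (hpi i * hpi j) :> hecke n).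
  by rewrite !mulrA br.
- by symmetry; exact: c.
Qed.

Definition chi : {alghom hecke n -> (hecke n)^c} := hecke_lift chi_family.

Lemma chi_hpi i : chi (hpi i) = hpi i.
Proof. exact: hecke_lift_hpi. Qed.

Lemma phiK : involutive phi.
Proof.
apply: (@hecke_hom_id n (phi \o phi)) => [r|x y|x y|i] /=.
- by rewrite !alghom_in_pzalg.
- by rewrite !rmorphD.
- by rewrite !rmorphM.
- rewrite !phi_hpi; congr hpi; apply: val_inj => /=.
  by rewrite subKn //; case/andP: (valP i) => _ /ltnW.
Qed.

Lemma thetaK : involutive theta.
Proof.
apply: (@hecke_hom_id n (theta \o theta)) => [r|x y|x y|i] /=.
- by rewrite !alghom_in_pzalg.
- by rewrite !rmorphD.
- by rewrite !rmorphM.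
- by rewrite theta_hpi rmorphB /= alghom_in_pzalg theta_hpi subKr.
Qed.

Lemma chiK : involutive (chi : hecke n -> hecke n).
Proof.
apply: (@hecke_hom_id n (fun x => chi (chi x : hecke n))) => [r|x y|x y|i].
- by rewrite !(@alghom_in_pzalg R _ _ chi).
- by rewrite !(rmorphD chi).
- by rewrite (rmorphM chi) (rmorphM chi).
- by rewrite !chi_hpi.
Qed.

Definition omega : {alghom hecke n -> hecke n} := phi \o theta.

End Automorphisms.

(* The map H_m (x) H_n -> H_p, for p = m + n, sending pi_i # 1 to pi_i and
   1 # pi_j to pi_(m + j). Restriction and induction between H_m (x) H_n and
   H_p are taken along it. The index p is kept as a variable so that
   H_m (x) H_n and H_n (x) H_m both map to the same algebra. *)
Section Parabolic.
Variables (m n p : nat) (mnp : (m + n)%N = p).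

Fact left_hidx_proof (i : hidx m) : (0 < val i < p)%N.
Proof. by rewrite -mnp; case: i => i /=; lia. Qed.

Fact right_hidx_proof (j : hidx n) : (0 < m + val j < p)%N.
Proof. by rewrite -mnp; case: j => j /=; lia. Qed.

Definition left_hidx (i : hidx m) : hidx p := Sub (val i) (left_hidx_proof i).
Definition right_hidx (j : hidx n) : hidx p :=
  Sub (m + val j)%N (right_hidx_proof j).

Fact left_family : hecke_family (fun i => hpi (left_hidx i)).
Proof.
by have [q br c] := hpi_family p;
  split=> [i|i j ij|i j ij]; [exact: q|exact: br|exact: c].
Qed.

Fact right_family : hecke_family (fun j => hpi (right_hidx j)).
Proof.
have [q br c] := hpi_family p; split=> [i|i j ij|i j ij]; first exact: q.
- by apply: br => /=; rewrite ij addnS.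
- by apply: c => /=; move: ij; rewrite -!addnS !leq_add2l.
Qed.

Definition par_incll : {alghom hecke m -> hecke p} := hecke_lift left_family.
Definition par_inclr : {alghom hecke n -> hecke p} := hecke_lift right_family.

Fact par_incl_comm : commuting_images par_incll par_inclr.
Proof.
move=> x y; apply: (hecke_commute (f := par_incll)) => i.
symmetry; apply: (hecke_commute (f := par_inclr)) => j.
rewrite /par_incll /par_inclr !hecke_lift_hpi.
apply: (hecke_comm (hpi_family p)) => /=.
by apply/orP; right; case: i j => [i ?] [j ?] /=; lia.
Qed.

Definition par_incl : {alghom talg (hecke m) (hecke n) -> hecke p} :=
  talg_lift par_incl_comm.

Lemma par_incl_pure x y : par_incl (tpure x y) = par_incll x * par_inclr y.
Proof. exact: talg_lift_pure. Qed.

Lemma par_incl_l i : par_incl (tpure (hpi i) 1) = hpi (left_hidx i).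
Proof.
rewrite par_incl_pure rmorph1 mulr1; exact: hecke_lift_hpi.
Qed.

Lemma par_incl_r j : par_incl (tpure 1 (hpi j)) = hpi (right_hidx j).
Proof.
rewrite par_incl_pure rmorph1 mul1r; exact: hecke_lift_hpi.
Qed.

Definition restr (L : lmodType (hecke p)) :
  lmodType (talg (hecke m) (hecke n)) := twist par_incl L.

Definition indprod (M : lmodType (hecke m)) (N : lmodType (hecke n)) :
  lmodType (hecke p) := induced par_incl (M \otimes N).

End Parabolic.

(* The restrictions of phi, theta and chi to H_m (x) H_n: see par_incl_phi_par,
   par_incl_theta_par and par_incl_chi_par. *)
Section ParabolicTwists.
Variables m n : nat.
Local Notation Hmn := (talg (hecke m) (hecke n)).
Local Notation Hnm := (talg (hecke n) (hecke m)).

Definition phi_parl : {alghom hecke m -> Hnm} :=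
  @tinr R (hecke n) (hecke m) \o phi m.
Definition phi_parr : {alghom hecke n -> Hnm} :=
  @tinl R (hecke n) (hecke m) \o phi n.

Fact phi_par_comm : commuting_images phi_parl phi_parr.
Proof. by move=> x y; exact/esym/tinlr_comm. Qed.

Definition phi_par : {alghom Hmn -> Hnm} := talg_lift phi_par_comm.

Definition theta_parl : {alghom hecke m -> Hmn} :=
  @tinl R (hecke m) (hecke n) \o theta m.
Definition theta_parr : {alghom hecke n -> Hmn} :=
  @tinr R (hecke m) (hecke n) \o theta n.

Fact theta_par_comm : commuting_images theta_parl theta_parr.
Proof. by move=> x y; exact: tinlr_comm. Qed.

Definition theta_par : {alghom Hmn -> Hmn} := talg_lift theta_par_comm.

Definition chi_parl : {alghom hecke m -> Hmn^c} :=
  conv_hom (@tinl R (hecke m) (hecke n)) \o chi m.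
Definition chi_parr : {alghom hecke n -> Hmn^c} :=
  conv_hom (@tinr R (hecke m) (hecke n)) \o chi n.

Fact chi_par_comm : commuting_images chi_parl chi_parr.
Proof. by move=> x y; exact/esym/tinlr_comm. Qed.

Definition chi_par : {alghom Hmn -> Hmn^c} := talg_lift chi_par_comm.

Lemma phi_par_pure x y : phi_par (tpure x y) = tpure (phi n y) (phi m x).
Proof.
rewrite [LHS](talg_lift_pure phi_par_comm) /=.
by rewrite [LHS]tpure_mul mul1r mulr1.
Qed.

Lemma theta_par_pure x y :
  theta_par (tpure x y) = tpure (theta m x) (theta n y).
Proof.
rewrite [LHS](talg_lift_pure theta_par_comm) /=.
by rewrite [LHS]tpure_mul mul1r mulr1.
Qed.

Lemma chi_par_pure x y :
  (chi_par (tpure x y) : Hmn) = tpure (chi m x : hecke m) (chi n y : hecke n).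
Proof.
rewrite [LHS](talg_lift_pure chi_par_comm).
rewrite -[LHS]/(tpure 1 (chi n y : hecke n) * tpure (chi m x : hecke m) 1).
by rewrite tpure_mul mul1r mulr1.
Qed.

Lemma talg_hom_ext (A B C : pzAlgType R) (f g : {alghom talg A B -> C}) :
  (forall x, f (tpure x 1) = g (tpure x 1)) ->
  (forall y, f (tpure 1 y) = g (tpure 1 y)) -> f =1 g.
Proof.
move=> fgl fgr; elim/talg_ind => [x y||t IHt|s t IHs IHt].
- by rewrite tpureE !rmorphM /= fgl fgr.
- by rewrite !rmorph0.
- by rewrite !rmorphN /= IHt.
- by rewrite !rmorphD /= IHs IHt.
Qed.

Section Compatibility.
Variables (p : nat) (mnp : (m + n)%N = p) (nmp : (n + m)%N = p).

Lemma par_incl_phi_par t : par_incl nmp (phi_par t) = phi p (par_incl mnp t).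
Proof.
apply: (talg_hom_ext (f := par_incl nmp \o phi_par)
                     (g := phi p \o par_incl mnp)).
- move=> x /=; rewrite phi_par_pure !par_incl_pure !rmorph1 mul1r mulr1.
  apply: (hecke_hom_ext (f := par_inclr nmp \o phi m)
                        (g := phi p \o par_incll mnp)).
  move=> i /=; rewrite phi_hpi !hecke_lift_hpi; congr hpi; apply: val_inj => /=.
  by case: i => i /= /andP[_ im]; rewrite -mnp; lia.
- move=> y /=; rewrite phi_par_pure !par_incl_pure !rmorph1 mul1r mulr1.
  apply: (hecke_hom_ext (f := par_incll nmp \o phi n)
                        (g := phi p \o par_inclr mnp)).
  move=> j /=; rewrite phi_hpi !hecke_lift_hpi; congr hpi; apply: val_inj => /=.
  by rewrite -mnp subnDl.
Qed.

Lemma par_incl_theta_par t :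
  par_incl mnp (theta_par t) = theta p (par_incl mnp t).
Proof.
apply: (talg_hom_ext (f := par_incl mnp \o theta_par)
                     (g := theta p \o par_incl mnp)).
- move=> x /=; rewrite theta_par_pure !par_incl_pure !rmorph1 !mulr1.
  apply: (hecke_hom_ext (f := par_incll mnp \o theta m)
                        (g := theta p \o par_incll mnp)).
  move=> i /=; rewrite theta_hpi rmorphB /= !hecke_lift_hpi.
  by rewrite alghom_in_pzalg.
- move=> y /=; rewrite theta_par_pure !par_incl_pure !rmorph1 !mul1r.
  apply: (hecke_hom_ext (f := par_inclr mnp \o theta n)
                        (g := theta p \o par_inclr mnp)).
  move=> j /=; rewrite theta_hpi rmorphB /= !hecke_lift_hpi.
  by rewrite alghom_in_pzalg.
Qed.

Lemma par_incl_chi_par t :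
  (par_incl mnp (chi_par t) : hecke p) = chi p (par_incl mnp t).
Proof.
apply: (talg_hom_ext (f := conv_hom (par_incl mnp) \o chi_par)
                     (g := chi p \o par_incl mnp)).
- move=> x /=; rewrite par_incl_pure !rmorph1 mulr1.
  have -> : chi_par (tpure x 1) = tpure (chi m x : hecke m) 1 :> Hmn.
    by rewrite [LHS]chi_par_pure; congr tpure; exact: (rmorph1 (chi n)).
  rewrite -[LHS]/(par_incl mnp (tpure (chi m x : hecke m) 1)).
  rewrite par_incl_pure rmorph1 mulr1.
  apply: (hecke_hom_ext (f := conv_hom (par_incll mnp) \o chi m)
                        (g := chi p \o par_incll mnp)).
  by move=> i /=; rewrite chi_hpi /conv_hom !hecke_lift_hpi.
- move=> y /=; rewrite par_incl_pure !rmorph1 mul1r.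
  have -> : chi_par (tpure 1 y) = tpure 1 (chi n y : hecke n) :> Hmn.
    by rewrite [LHS]chi_par_pure; congr tpure; exact: (rmorph1 (chi m)).
  rewrite -[LHS]/(par_incl mnp (tpure 1 (chi n y : hecke n))).
  rewrite par_incl_pure rmorph1 mul1r.
  apply: (hecke_hom_ext (f := conv_hom (par_inclr mnp) \o chi n)
                        (g := chi p \o par_inclr mnp)).
  by move=> j /=; rewrite chi_hpi /conv_hom !hecke_lift_hpi.
Qed.

End Compatibility.
End ParabolicTwists.
End Hecke.

(* Main.v *)
Require Import Defs.
From HB Require Import structures.
From mathcomp Require Import all_boot all_algebra.
From mathcomp Require Import boolp.
Import GRing.Theory.
Local Open Scope ring_scope.

(** Induction and restriction are transported by isomorphisms of the algebras
    involved. Suppose that ring morphisms [al] of the big algebras and [be] of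
    the small ones intertwine the morphisms [mu] and [mu'] along which modules
    are induced, that is [mu' \o be = al \o mu]. Then [x # y |-> al x # y] is
    an [A]-linear map from [A (x)_B be[N']] to [al[A' (x)_B' N']], and it is an
    isomorphism as soon as [al] is bijective and [be] is surjective
    ([lmod_iso_induced_twist]). For Hecke algebras the squares commute because
    both sides agree on the generators: [phi] reverses the indices
    [1, ..., m + n - 1], hence carries the parabolic subalgebra omitting [pi_n]
    to the one omitting [pi_m] and exchanges its two tensor factors, while
    [theta] preserves each factor. So the twists by [phi], [theta] and [omega]
    of the induction product of [M] and [N] are induced from a twist of their
    tensor product over [R], which is the tensor product of the twisted
    modules, with an exchange of the factors for [phi] and [omega]
    ([lmod_iso_mtens_twist], [lmod_iso_mtens_twist_swap]).

    The statements on restriction compare two modules on the same underlying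
    set, and the same commuting squares say that the two actions coincide
    ([lmod_iso_twist_restr]). For [chi] the underlying set consists of the
    [R]-linear forms on [L], and restriction does not change the action of [R]
    ([lmod_iso_dual_twist_restr]). *)

(** * Isomorphisms of modules *)

Section LmodIso.
Variable A : pzRingType.
Implicit Types U V : lmodType A.

Lemma lmod_isoI U V (f : U -> V) (g : V -> U) :
  {morph f : x y / x + y} -> (forall a x, f (a *: x) = a *: f x) ->
  cancel f g -> cancel g f -> lmod_iso U V.
Proof.
move=> fD fZ fK gK.
have f_lin : linear f by move=> a x y; rewrite fD fZ.
pose F := GRing.isLinear.Build A U V *:%R f f_lin.
pose fL : {linear U -> V} := HB.pack f F.
by exists fL; exists g.
Qed.

Lemma lmod_iso_sym U V : lmod_iso U V -> lmod_iso V U.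
Proof.
case=> f [g fK gK].
have fI : injective (f : U -> V) := can_inj fK.
have {}gK (x : V) : f (g x) = x by exact: gK.
apply: (@lmod_isoI _ _ g f) => // [x y|a x].
- by apply: fI; rewrite gK [RHS]raddfD /= !gK.
- by apply: fI; rewrite gK [RHS]linearZ /= gK.
Qed.

End LmodIso.

(** * Induction of twisted modules *)

Section InducedTwist.
Variables (A B A' B' : pzRingType).
Variables (mu : {rmorphism B -> A}) (mu' : {rmorphism B' -> A'}).
Variables (al : {rmorphism A -> A'}) (be : {rmorphism B -> B'}).
Hypothesis mu_be : forall b, mu' (be b) = al (mu b).
Variables (al' : A' -> A) (be' : B' -> B).
Hypotheses (alK : cancel al al') (al'K : cancel al' al) (be'K : cancel be' be).
Variables (N : lmodType B) (N' : lmodType B').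
Variables (f : {linear N -> twist be N'}) (g : N' -> N).
Hypotheses (fK : cancel f g) (gK : cancel g f).

Lemma induced_twist_bilin :
  tens_bilin (fun (x : A) (b : B) => x * mu b)
             (fun (b : B) (y : N) => b *: y)
             (fun x y => ipure mu' (al x) (f y)).
Proof.
split=> [x x' y|x y y'|x b y].
- by rewrite rmorphD; exact: tens_pureDl.
- by rewrite raddfD; exact: tens_pureDr.
- by rewrite rmorphM -mu_be linearZ; exact: tens_bal.
Qed.

(** The inverse map is balanced because every scalar [b] in [B'] has the form
    [be (be' b)]. *)
Lemma induced_untwist_bilin :
  tens_bilin (fun (x : A') (b : B') => x * mu' b)
             (fun (b : B') (y : N') => b *: y)
             (fun x y => ipure mu (al' x) (g y)).
Proof.
split=> [x x' y|x y y'|x b y].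
- have -> : al' (x + x') = al' x + al' x'.
    by apply: (can_inj alK); rewrite rmorphD !al'K.
  exact: tens_pureDl.
- have -> : g (y + y') = g y + g y'.
    by apply: (can_inj fK); rewrite raddfD /= !gK.
  exact: tens_pureDr.
- have -> : al' (x * mu' b) = al' x * mu (be' b).
    by apply: (can_inj alK); rewrite rmorphM -mu_be be'K !al'K.
  have -> : g (b *: y) = be' b *: g y.
    by apply: (can_inj fK); rewrite linearZ /= twist_scaleE be'K !gK.
  exact: tens_bal.
Qed.

(** The modules [N] and [be[N']] are only assumed isomorphic, by [f], rather
    than equal: this allows [N] to be a tensor product of twisted modules and
    [N'] the tensor product of the modules themselves. *)
Lemma lmod_iso_induced_twist :
  lmod_iso (induced mu N) (twist al (induced mu' N')).
Proof.
pose F : {additive induced mu N -> induced mu' N'} :=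
  tens_lift induced_twist_bilin.
pose G : {additive induced mu' N' -> induced mu N} :=
  tens_lift induced_untwist_bilin.
have FE x y : F (ipure mu x y) = ipure mu' (al x) (f y).
  exact: tens_lift_pure.
have GE x y : G (ipure mu' x y) = ipure mu (al' x) (g y).
  exact: tens_lift_pure.
apply: (@lmod_isoI A (induced mu N) (twist al (induced mu' N')) F G)
  => [x y|c t|t|t].
- exact: raddfD.
- rewrite [RHS]twist_scaleE.
  elim/induced_ind: t => [x y||t IHt|s t IHs IHt].
  + by rewrite ipure_scale !FE rmorphM ipure_scale.
  + by rewrite !(scaler0, raddf0).
  + by rewrite scalerN !raddfN /= IHt.
  + by rewrite scalerDr !raddfD /= IHs IHt.
- apply: (induced_ext (f := G \o F) (g := idfun)) => x y /=.
  by rewrite FE GE alK fK.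
- apply: (induced_ext (f := F \o G) (g := idfun)) => x y /=.
  by rewrite GE FE al'K gK.
Qed.

End InducedTwist.

(** * Tensor products of twisted modules *)

Section TensorTwist.
Variable R : comPzRingType.
Implicit Types A B C : pzAlgType R.

Lemma mtens_semilinear {A B C} (be : {alghom talg A B -> C})
    (M : lmodType A) (N : lmodType B) (P : lmodType C)
    (F : {additive M \otimes N -> P}) :
    (forall x y u v,
      F (mpure (x *: u) (y *: v)) = be (tpure x y) *: F (mpure u v)) ->
  forall c t, F (c *: t) = be c *: F t.
Proof.
move=> FE c t; elim/talg_ind: c => [x y||c IHc|c c' IHc IHc'].
- elim/mtens_ind: t => [u v||t IHt|s t IHs IHt].
  + by rewrite mtens_scale_pure FE.
  + by rewrite !(scaler0, raddf0).
  + by rewrite scalerN !raddfN /= IHt.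
  + by rewrite scalerDr !raddfD /= IHs IHt.
- by rewrite !(scale0r, raddf0).
- by rewrite scaleNr !raddfN /= IHc scaleNr.
- by rewrite scalerDl !raddfD /= IHc IHc' scalerDl.
Qed.

(** Twisting along an [R]-algebra morphism keeps the [R]-module structure, so
    the tensor products over [R] below have the same balancing relations. *)
Lemma twist_in_pzalg {A B} (h : {alghom A -> B}) (V : lmodType B) (r : R)
    (v : V) :
  in_pzalg r *: (v : twist h V) = in_pzalg r *: v :> V.
Proof. by rewrite twist_scaleE /= alghom_in_pzalg. Qed.

Variables (A A' B B' : pzAlgType R).
Variables (f : {alghom A -> A'}) (g : {alghom B -> B'}).
Variables (M : lmodType A') (N : lmodType B').
Let fM : lmodType A := twist f M.
Let gN : lmodType B := twist g N.

Lemma mtens_twist_bilin :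
  tens_bilin (fun (u : fM) (r : R) => in_pzalg r *: u)
             (fun (r : R) (v : gN) => in_pzalg r *: v)
             (fun u v => mpure (u : M) (v : N)).
Proof.
split=> [u u' v|u v v'|u r v]; first exact: tens_pureDl.
- exact: tens_pureDr.
- by rewrite !twist_in_pzalg; exact: tens_bal.
Qed.

Lemma mtens_untwist_bilin :
  tens_bilin (fun (u : M) (r : R) => in_pzalg r *: u)
             (fun (r : R) (v : N) => in_pzalg r *: v)
             (fun u v => mpure (u : fM) (v : gN)).
Proof.
split=> [u u' v|u v v'|u r v]; first exact: tens_pureDl.
- exact: tens_pureDr.
- rewrite -(twist_in_pzalg f) -(twist_in_pzalg g); exact: tens_bal.
Qed.

Lemma lmod_iso_mtens_twist (be : {alghom talg A B -> talg A' B'}) :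
  (forall x y, be (tpure x y) = tpure (f x) (g y)) ->
  lmod_iso (fM \otimes gN) (twist be (M \otimes N)).
Proof.
move=> beE.
pose F : {additive fM \otimes gN -> M \otimes N} :=
  tens_lift mtens_twist_bilin.
pose G : {additive M \otimes N -> fM \otimes gN} :=
  tens_lift mtens_untwist_bilin.
have FE u v : F (mpure (u : fM) (v : gN)) = mpure (u : M) (v : N).
  exact: tens_lift_pure.
have GE u v : G (mpure (u : M) (v : N)) = mpure (u : fM) (v : gN).
  exact: tens_lift_pure.
apply: (@lmod_isoI _ (fM \otimes gN) (twist be (M \otimes N)) F G)
  => [x y|c t|t|t].
- exact: raddfD.
- apply: (mtens_semilinear be _ _ (M \otimes N) F) => x y u v.
  by rewrite !FE beE mtens_scale_pure.
- by apply: (mtens_ext (f := G \o F) (g := idfun)) => u v /=; rewrite FE GE.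
- by apply: (mtens_ext (f := F \o G) (g := idfun)) => u v /=; rewrite GE FE.
Qed.

Lemma mtens_twist_swap_bilin :
  tens_bilin (fun (u : fM) (r : R) => in_pzalg r *: u)
             (fun (r : R) (v : gN) => in_pzalg r *: v)
             (fun u v => mpure (v : N) (u : M)).
Proof.
split=> [u u' v|u v v'|u r v]; first exact: tens_pureDr.
- exact: tens_pureDl.
- by rewrite !twist_in_pzalg; symmetry; exact: tens_bal.
Qed.

Lemma mtens_untwist_swap_bilin :
  tens_bilin (fun (v : N) (r : R) => in_pzalg r *: v)
             (fun (r : R) (u : M) => in_pzalg r *: u)
             (fun v u => mpure (u : fM) (v : gN)).
Proof.
split=> [v v' u|v u u'|v r u]; first exact: tens_pureDr.
- exact: tens_pureDl.
- rewrite -(twist_in_pzalg f) -(twist_in_pzalg g).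
  symmetry; exact: tens_bal.
Qed.

Lemma lmod_iso_mtens_twist_swap (be : {alghom talg A B -> talg B' A'}) :
  (forall x y, be (tpure x y) = tpure (g y) (f x)) ->
  lmod_iso (fM \otimes gN) (twist be (N \otimes M)).
Proof.
move=> beE.
pose F : {additive fM \otimes gN -> N \otimes M} :=
  tens_lift mtens_twist_swap_bilin.
pose G : {additive N \otimes M -> fM \otimes gN} :=
  tens_lift mtens_untwist_swap_bilin.
have FE u v : F (mpure (u : fM) (v : gN)) = mpure (v : N) (u : M).
  exact: tens_lift_pure.
have GE u v : G (mpure (v : N) (u : M)) = mpure (u : fM) (v : gN).
  exact: tens_lift_pure.
apply: (@lmod_isoI _ (fM \otimes gN) (twist be (N \otimes M)) F G)
  => [x y|c t|t|t].
- exact: raddfD.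
- apply: (mtens_semilinear be _ _ (N \otimes M) F) => x y u v.
  by rewrite !FE beE mtens_scale_pure.
- by apply: (mtens_ext (f := G \o F) (g := idfun)) => u v /=; rewrite FE GE.
- by apply: (mtens_ext (f := F \o G) (g := idfun)) => v u /=; rewrite GE FE.
Qed.

End TensorTwist.

(** * Restriction of twisted modules *)

Lemma lmod_iso_twist_restr {A B A' B' : pzRingType}
    (mu : {rmorphism B -> A}) (mu' : {rmorphism B' -> A'})
    (al : {rmorphism A -> A'}) (be : {rmorphism B -> B'}) (L : lmodType A') :
  (forall t, mu' (be t) = al (mu t)) ->
  lmod_iso (twist be (twist mu' L)) (twist mu (twist al L)).
Proof.
move=> compat.
apply: (@lmod_isoI _ (twist be (twist mu' L)) (twist mu (twist al L)) id id)
  => // t x.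
by rewrite !twist_scaleE compat.
Qed.

Section DualRestr.
Context {R : comPzRingType} {A B : pzAlgType R} (mu : {alghom B -> A}).
Variable L : lmodType A.

(** As [mu] is a morphism of [R]-algebras, [R] acts in the same way on [L] and
    on its restriction, so both have the same linear forms. *)
Lemma is_functional_twist (f : L -> R) :
  is_functional (V := twist mu L) f = is_functional (V := L) f.
Proof.
have scale_twist (r : R) (v : L) :
    r *: (v : basemod (twist mu L)) = r *: (v : basemod L) :> L.
  exact: twist_in_pzalg.
apply/asboolP/asboolP => f_lin r u v; rewrite -[RHS](f_lin r u v).
- by congr (f (_ + _)); exact/esym/scale_twist.
- by congr (f (_ + _)); exact: scale_twist.
Qed.

Lemma lmod_iso_dual_twist_restr (nuA : {rmorphism A -> A^c})
    (nuB : {rmorphism B -> B^c}) :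
  (forall t, (mu (nuB t) : A) = nuA (mu t)) ->
  lmod_iso (dual_twist nuB (twist mu L)) (twist mu (dual_twist nuA L)).
Proof.
move=> compat.
pose F (d : dual_twist nuB (twist mu L)) : dual_twist nuA L :=
  exist _ (val d) (etrans (esym (is_functional_twist (val d))) (valP d)).
pose G (d : dual_twist nuA L) : dual_twist nuB (twist mu L) :=
  exist _ (val d) (etrans (is_functional_twist (val d)) (valP d)).
apply: (@lmod_isoI _ (dual_twist nuB (twist mu L))
  (twist mu (dual_twist nuA L)) F G) => [d e|t d|d|d];
  apply: functional_ext => v //.
change (val d (mu (nuB t) *: (v : L)) = val d ((nuA (mu t) : A) *: (v : L))).
by rewrite compat.
Qed.

End DualRestr.

(** * Induction products of modules over Hecke algebras *)

Section HeckeTwist.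
Variables (R : comPzRingType) (a b : R).
Local Notation H := (hecke a b).

Lemma lmod_iso_indprod_twist {m n m' n' p}
    (h : (m + n)%N = p) (h' : (m' + n')%N = p)
    (al : {alghom H p -> H p}) (al' : H p -> H p)
    (be : {alghom talg (H m) (H n) -> talg (H m') (H n')})
    (be' : talg (H m') (H n') -> talg (H m) (H n))
    (M : lmodType (H m)) (N : lmodType (H n))
    (M' : lmodType (H m')) (N' : lmodType (H n')) :
  (forall t, par_incl a b h' (be t) = al (par_incl a b h t)) ->
  cancel al al' -> cancel al' al -> cancel be' be ->
  lmod_iso (M \otimes N) (twist be (M' \otimes N')) ->
  lmod_iso (twist al (indprod h' M' N')) (indprod h M N).
Proof.
move=> compat alK al'K be'K [f [g fK gK]]; apply: lmod_iso_sym.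
exact: (lmod_iso_induced_twist _ _ _ _ _ _ al be compat al' be' alK al'K be'K
  _ _ f g fK gK).
Qed.

Lemma talg_endo_id {A B : pzAlgType R} (f : {additive talg A B -> talg A B}) :
  (forall x y, f (tpure x y) = tpure x y) -> f =1 id.
Proof. exact: (mtens_ext (M := A^o) (N := B^o) (f := f) (g := idfun)). Qed.

Lemma phi_parK m n : cancel (phi_par a b m n) (phi_par a b n m).
Proof.
apply: (talg_endo_id (phi_par a b n m \o phi_par a b m n)) => x y /=.
by rewrite !phi_par_pure !phiK.
Qed.

Lemma theta_parK m n : involutive (theta_par a b m n).
Proof.
apply: (talg_endo_id (theta_par a b m n \o theta_par a b m n)) => x y /=.
by rewrite !theta_par_pure !thetaK.
Qed.

Section IndProd.
Variables (m n p : nat) (mnp : (m + n)%N = p) (nmp : (n + m)%N = p).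
Variables (M : lmodType (H m)) (N : lmodType (H n)).

Lemma lmod_iso_phi_indprod :
  lmod_iso (twist (phi a b p) (indprod mnp M N))
    (indprod nmp (twist (phi a b n) N) (twist (phi a b m) M)).
Proof.
apply: (lmod_iso_indprod_twist nmp mnp (phi a b p) (phi a b p)
  (phi_par a b n m) (phi_par a b m n)).
- exact: par_incl_phi_par.
- exact: phiK.
- exact: phiK.
- exact: phi_parK.
- by apply: lmod_iso_mtens_twist_swap => x y; exact: phi_par_pure.
Qed.

Lemma lmod_iso_theta_indprod :
  lmod_iso (twist (theta a b p) (indprod mnp M N))
    (indprod mnp (twist (theta a b m) M) (twist (theta a b n) N)).
Proof.
apply: (lmod_iso_indprod_twist mnp mnp (theta a b p) (theta a b p)
  (theta_par a b m n) (theta_par a b m n)).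
- exact: par_incl_theta_par.
- exact: thetaK.
- exact: thetaK.
- exact: theta_parK.
- by apply: lmod_iso_mtens_twist => x y; exact: theta_par_pure.
Qed.

Lemma lmod_iso_omega_indprod :
  lmod_iso (twist (omega a b p) (indprod mnp M N))
    (indprod nmp (twist (omega a b n) N) (twist (omega a b m) M)).
Proof.
apply: (lmod_iso_indprod_twist nmp mnp (omega a b p)
  (theta a b p \o phi a b p) (phi_par a b n m \o theta_par a b n m)
  (theta_par a b n m \o phi_par a b m n)).
- by move=> t /=; rewrite (par_incl_phi_par nmp mnp) par_incl_theta_par.
- by move=> x; rewrite /= phiK thetaK.
- by move=> x; rewrite /= thetaK phiK.
- by move=> t; rewrite /= theta_parK phi_parK.
- apply: lmod_iso_mtens_twist_swap => x y /=.
  by rewrite theta_par_pure phi_par_pure.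
Qed.

End IndProd.

End HeckeTwist.

Theorem theorem4p4 (R : comPzRingType) (a b : R) (m n : nat)
    (m_ge1 : (1 <= m)%N) (n_ge1 : (1 <= n)%N)
    (M : lmodType (hecke a b m)) (N : lmodType (hecke a b n)) :
  [/\ lmod_iso (A := hecke a b (m + n))
        (twist (phi a b (m + n)) (indprod (erefl (m + n)%N) M N))
        (indprod (addnC n m) (twist (phi a b n) N) (twist (phi a b m) M)),
      lmod_iso (A := hecke a b (m + n))
        (twist (theta a b (m + n)) (indprod (erefl (m + n)%N) M N))
        (indprod (erefl (m + n)%N)
           (twist (theta a b m) M) (twist (theta a b n) N)) &
      lmod_iso (A := hecke a b (m + n))
        (twist (omega a b (m + n)) (indprod (erefl (m + n)%N) M N))
        (indprod (addnC n m) (twist (omega a b n) N) (twist (omega a b m) M))]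
  /\
  forall L : lmodType (hecke a b (m + n)),
  [/\ lmod_iso (A := talg (hecke a b m) (hecke a b n))
        (twist (phi_par a b m n) (restr (addnC n m) L))
        (restr (erefl (m + n)%N) (twist (phi a b (m + n)) L)),
      lmod_iso (A := talg (hecke a b m) (hecke a b n))
        (twist (theta_par a b m n) (restr (erefl (m + n)%N) L))
        (restr (erefl (m + n)%N) (twist (theta a b (m + n)) L)) &
      free_of_finite_rank (basemod L) ->
      lmod_iso (A := talg (hecke a b m) (hecke a b n))
        (dual_twist (chi_par a b m n) (restr (erefl (m + n)%N) L))
        (restr (erefl (m + n)%N) (dual_twist (chi a b (m + n)) L))].
Proof.
split=> [|L]; split.
- exact: lmod_iso_phi_indprod.
- exact: lmod_iso_theta_indprod.
- exact: lmod_iso_omega_indprod.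
- apply: (lmod_iso_twist_restr (par_incl a b (erefl (m + n)%N))
    (par_incl a b (addnC n m)) (phi a b (m + n)) (phi_par a b m n)).
  exact: par_incl_phi_par.
- apply: (lmod_iso_twist_restr (par_incl a b (erefl (m + n)%N))
    (par_incl a b (erefl (m + n)%N)) (theta a b (m + n)) (theta_par a b m n)).
  exact: par_incl_theta_par.
- move=> _.
  exact (lmod_iso_dual_twist_restr (par_incl a b (erefl (m + n)%N)) L
    (chi a b (m + n)) (chi_par a b m n) (par_incl_chi_par (erefl (m + n)%N))).
Qed.
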